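(* There is an absolute constant $c>0$ such that the following holds. For any $\varepsilon>0$ there is a $\delta=\delta(\varepsilon)\ge c\varepsilon$ (i.e. $\delta=\Omega(\varepsilon)$) such that for every triangle-free $n$-vertex graph $G$, if $\mathrm{im}(G)<(1-\varepsilon)\frac{n}{2}$, then $\log\mathrm{mis}(G)<\left(\frac{1}{2}-\delta\right)n$.
   Context: $\mathrm{mis}(G)$ denotes the number of maximal independent sets of $G$, and $\log=\log_2$. An induced matching of $G$ is an induced subgraph of $G$ that is a matching; $\mathrm{im}(G)$ is the number of edges in a largest induced matching of $G$. *)

(* Defs.v *)
From HB Require Import structures.
From mathcomp Require Import all_boot all_order all_algebra.
From mathcomp Require Import reals exp.

Set Implicit Arguments.
Unset Strict Implicit.
Unset Printing Implicit Defensive.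

Import Order.TTheory GRing.Theory Num.Theory.

Record sgraph := SGraph {
  vertex :> finType;
  adj : rel vertex;
  adj_sym : symmetric adj;
  adj_irrefl : irreflexive adj
}.

Section GraphParameters.
Variable G : sgraph.
Implicit Type S : {set G}.

Definition triangle_free : Prop :=
  forall x y z : G, ~~ [&& adj x y, adj y z & adj z x].

Definition independent S : bool :=
  [forall x in S, forall y in S, ~~ adj x y].

Definition mis : nat := #|[set S : {set G} | maxset independent S]|.

(* Edges are unordered pairs, so each edge is counted once. *)
Definition induced_edges S : {set {set G}} :=
  [set [set x; y] | x in S, y in S & adj x y].

(* G[S] is a matching: its edges are pairwise disjoint and, as a matching is
   determined by its edges, it has no isolated vertex. *)
Definition induced_matching S : bool :=
  trivIset (induced_edges S) && (cover (induced_edges S) == S).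

Definition im : nat :=
  \max_(S : {set G} | induced_matching S) #|induced_edges S|.

End GraphParameters.

Definition log2 (R : realType) (x : R) : R := (ln x / ln 2)%R.

(* Main.v *)
Require Import Defs.
From HB Require Import structures.
From mathcomp Require Import all_boot all_order all_algebra.
From mathcomp Require Import reals exp.
From mathcomp Require Import ring lra zify.

Set Implicit Arguments.
Unset Strict Implicit.
Unset Printing Implicit Defensive.

Import Order.TTheory GRing.Theory Num.Theory.
Local Open Scope ring_scope.

(** Put [a = 7/5] and [b = 50/49], so that [a ^ 2 * b = 2] and [b > 1].
Induction on the number of vertices gives [mis G <= a ^ n * b ^ im G] for every
triangle-free [G]; taking logarithms, [log mis G <= n/2 - (log b) (n/2 - im G)],
which yields the theorem with [c = (log b) / 2].

In the induction, [im] can only decrease when vertices are deleted, and the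
branchings are:
- a vertex [v] of degree at least 3: [mis G <= mis (G - v) + mis (G - N[v])],
  and [1/a + 1/a^4 <= 1];
- a leaf [v] whose neighbour [u] has degree at least 2:
  [mis G <= mis (G - N[v]) + mis (G - N[u])], and [1/a^2 + 1/a^3 <= 1];
- an isolated edge: [mis] is halved, [n] drops by 2 and [im] by 1, and
  [a ^ 2 * b = 2];
- [G] is 2-regular: after deleting [v], a neighbour of [v] becomes a leaf whose
  neighbour still has degree 2 since [G] has no triangle, and
  [2/a^3 + 1/a^4 <= 1]. *)

(** * Maximal independent sets and induced matchings in induced subgraphs *)

Section InducedSubgraphs.
Variable G : sgraph.
Implicit Types (U V S : {set G}) (u v x y : G).

Definition nbr v : {set G} := [set y | adj v y].

Definition cnbr v : {set G} := v |: nbr v.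

(* The maximal independent sets of [G[U]], as independent dominating sets. *)
Definition MIS U : {set {set G}} :=
  [set S : {set G} | [&& S \subset U, independent S &
     [forall x in U :\: S, exists y in S, adj x y]]].

(** The induced matching number of [G[U]]: for [S \subset U], the graphs [G] and [G[U]] induce the
    same edges on [S]. Working with subsets of a fixed [G] avoids building a new graph at each
    deletion. *)
Definition imU U : nat :=
  \max_(S : {set G} | induced_matching S && (S \subset U)) #|induced_edges S|.

Lemma independentP S :
  reflect {in S &, forall x y, ~~ adj x y} (independent S).
Proof.
apply: (iffP forall_inP) => iS x.
  by move=> y xS; move: y; apply/forall_inP/iS.
by move=> xS; apply/forall_inP => y; exact: iS.
Qed.

Lemma MISP U S :
  reflect [/\ S \subset U, {in S &, forall x y, ~~ adj x y} &
              forall x, x \in U -> x \notin S -> exists2 y, y \in S & adj x y]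
          (S \in MIS U).
Proof.
rewrite inE; apply: (iffP and3P) => -[SU /independentP iS dom]; split=> //.
- move=> x xU xS; move/forall_inP: dom => /(_ x).
  by rewrite inE xU xS => /(_ isT)/exists_inP[y]; exists y.
- apply/forall_inP => x; rewrite inE => /andP[xS xU]; apply/exists_inP.
  by have [y yS xy] := dom x xU xS; exists y.
Qed.

Lemma mis_MIS : mis G = #|MIS setT|.
Proof.
rewrite /mis; apply: eq_card => S; rewrite inE; apply/maxsetP/MISP.
  move=> [/independentP iS maxS]; split=> // x _ xS.
  apply/exists_inP; apply: contraT; rewrite negb_exists_in => /forall_inP nadj.
  have iS' : independent (x |: S).
    apply/independentP => y z /setU1P[->|yS] /setU1P[->|zS].
    - by rewrite adj_irrefl.
    - exact: nadj.
    - by rewrite adj_sym; exact: nadj.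
    - exact: iS.
  by rewrite -(maxS _ iS' (subsetUr _ _)) setU11 in xS.
move=> [_ iS dom]; split; first exact/independentP.
move=> T /independentP iT ST; apply/eqP; rewrite eqEsubset ST andbT.
apply/subsetP => x xT; apply: contraT => xS.
have [y yS xy] := dom x (in_setT x) xS.
by have := iT x y xT (subsetP ST _ yS); rewrite xy.
Qed.

Lemma mis_gt0 : (0 < mis G)%N.
Proof.
have i0 : independent (set0 : {set G}).
  by apply/independentP => x y; rewrite inE.
have [S maxS _] := maxset_exists i0.
by apply/card_gt0P; exists S; rewrite inE.
Qed.

Lemma im_imU : im G = imU setT.
Proof. by apply: eq_bigl => S; rewrite subsetT andbT. Qed.

Lemma imU_mono U V : V \subset U -> (imU V <= imU U)%N.
Proof.
move=> VU; apply/bigop.bigmax_leqP => S /andP[mS SV].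
by apply: (bigop.bigmax_sup S) => //; rewrite mS (subset_trans SV).
Qed.

(** Removing [v] is injective on the sets that contain it. The result still dominates
    [U :\: cnbr v], since a vertex outside [cnbr v] is never dominated by [v] itself. *)
Lemma card_MIS_mem U v :
  (#|[set S in MIS U | v \in S]| <= #|MIS (U :\: cnbr v)|)%N.
Proof.
rewrite -(card_in_imset (f := fun S => S :\ v)); last first.
  move=> S T; rewrite !inE => /andP[_ vS] /andP[_ vT] eST.
  by rewrite -(setD1K vS) eST setD1K.
apply/subset_leq_card/subsetP => _ /imsetP[S + ->].
rewrite inE => /andP[/MISP[SU iS dom] vS]; apply/MISP; split.
- apply/subsetP => x /setD1P[xv xS]; rewrite !inE negb_or xv (subsetP SU) //.
  by rewrite andbT iS.
- by move=> x y /setD1P[_ xS] /setD1P[_ yS]; exact: iS.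
- move=> x; rewrite !inE negb_or => /andP[/andP[xv vx] xU].
  rewrite xv /= => xS; have [y yS xy] := dom x xU xS.
  exists y => //; rewrite !inE yS andbT.
  by apply: contraNneq vx => <-; rewrite adj_sym.
Qed.

Lemma card_MIS_split U v : (#|MIS U| <=
  #|MIS (U :\: cnbr v)| + #|[set S in MIS U | v \notin S]|)%N.
Proof.
rewrite (leq_trans _ (leq_add (card_MIS_mem U v) (leqnn _))) //.
rewrite (leq_trans _ (leq_card_setU _ _)) //.
apply/subset_leq_card/subsetP => S SU; rewrite !inE.
by rewrite inE in SU; rewrite SU orbN.
Qed.

(** A maximal independent set that avoids [v] stays maximal once [v] is deleted, as fewer vertices
    must be dominated. *)
Lemma card_MIS_del U v :
  (#|MIS U| <= #|MIS (U :\: cnbr v)| + #|MIS (U :\ v)|)%N.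
Proof.
rewrite (leq_trans (card_MIS_split U v)) // leq_add2l.
apply/subset_leq_card/subsetP => S; rewrite inE => /andP[/MISP[SU iS dom] vS].
apply/MISP; split=> //; first by rewrite subsetD1 SU.
by move=> x /setD1P[_ xU]; exact: dom.
Qed.

(** If the leaf [v] is left out, only [u] can dominate it, so [u] is in the set. *)
Lemma card_MIS_leaf U v u : v \in U -> nbr v :&: U = [set u] ->
  (#|MIS U| <= #|MIS (U :\: cnbr v)| + #|MIS (U :\: cnbr u)|)%N.
Proof.
move=> vU Nv; rewrite (leq_trans (card_MIS_split U v)) // leq_add2l.
rewrite (leq_trans _ (card_MIS_mem U u)) //.
apply/subset_leq_card/subsetP => S; rewrite inE => /andP[SU vS].
rewrite inE SU /=; have /MISP[sSU _ dom] := SU.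
have [y yS vy] := dom v vU vS.
suff /set1P <- : y \in [set u] by [].
by rewrite -Nv !inE vy (subsetP sSU).
Qed.

Lemma card_MIS_isolated U v : v \in U -> nbr v :&: U = set0 ->
  (#|MIS U| <= #|MIS (U :\: cnbr v)|)%N.
Proof.
move=> vU Nv; rewrite (leq_trans (card_MIS_split U v)) //.
rewrite -[leqRHS]addn0 leq_add2l leqn0 cards_eq0; apply/eqP/setP => S.
rewrite inE [RHS]inE; apply/negbTE/negP => /andP[/MISP[SU _ dom] vS].
have [y yS vy] := dom v vU vS.
suff : y \in set0 by rewrite inE.
by rewrite -Nv !inE vy (subsetP SU).
Qed.

Lemma card_MIS0 : (#|MIS set0| <= 1)%N.
Proof.
rewrite -(cards1 (set0 : {set G})); apply/subset_leq_card/subsetP => S.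
by move=> /MISP[]; rewrite subset0 inE.
Qed.

Lemma card_cnbrD U v : v \in U ->
  (#|U :\: cnbr v| + #|nbr v :&: U|.+1 = #|U|)%N.
Proof.
move=> vU; rewrite -(cardsID (cnbr v) U) addnC; congr (_ + _)%N.
have -> : U :&: cnbr v = v |: (nbr v :&: U).
  by rewrite setIC setIUl (setIidPl _) // sub1set.
by rewrite cardsU1 !inE adj_irrefl.
Qed.

(** An optimal induced matching of the rest extends by the edge [vu], which has no neighbour in
    [U]. *)
Lemma imU_isolated_edge U v u :
  nbr v :&: U = [set u] -> nbr u :&: U = [set v] ->
  (imU (U :\: cnbr v) < imU U)%N.
Proof.
move=> Nv Nu.
have /setIP[] : u \in nbr v :&: U by rewrite Nv set11.
have /setIP[] : v \in nbr u :&: U by rewrite Nu set11.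
rewrite !inE => uv vU vu uU.
have [|S /andP[/andP[tS /eqP cS] SU] maxS] :=
  @eq_bigmax_cond _ [pred S | induced_matching S & S \subset U :\: cnbr v]
    (fun S => #|induced_edges S|).
  (* The maximum is attained only if some set is admissible; the empty one is. *)
  apply/card_gt0P; exists set0; rewrite inE sub0set andbT.
  have -> : induced_matching (set0 : {set G}).
    have e0 : induced_edges (set0 : {set G}) = set0.
      apply/setP => e; rewrite [RHS]inE; apply/negP => /imset2P[x y x0].
      by rewrite inE in x0.
    rewrite /induced_matching e0 /cover big_set0 eqxx andbT.
    by apply/trivIsetP => A B; rewrite inE.
  by [].
rewrite /imU maxS.
have SUv x : x \in S -> [/\ x \in U, x != v, x != u, ~~ adj v x & ~~ adj u x].
  move=> /(subsetP SU); rewrite !inE negb_or => /andP[/andP[xv vx] xU].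
  split=> //; first by apply: contraNneq vx => ->.
  apply/negP => ux; have : x \in [set v] by rewrite -Nu !inE ux xU.
  by rewrite inE (negbTE xv).
have eE : induced_edges (v |: (u |: S)) = [set v; u] |: induced_edges S.
  apply/setP => e; rewrite !inE; apply/imset2P/orP.
    move=> [x y]; rewrite !inE => xS /andP[yS xy] ->.
    case/or3P: xS yS xy => [/eqP->|/eqP->|xS] /or3P[/eqP->|/eqP->|yS];
      rewrite ?adj_irrefl // => xy.
    - by left.
    - by have [] := SUv y yS; rewrite xy.
    - by left; rewrite setUC.
    - by have [] := SUv y yS; rewrite xy.
    - by have [] := SUv x xS; rewrite (adj_sym v) xy.
    - by have [] := SUv x xS; rewrite (adj_sym u) xy.
    - by right; apply/imset2P; exists x y; rewrite // inE yS.
  move=> [/eqP->|/imset2P[x y xS]].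
    by exists v u; rewrite // !inE ?eqxx ?orbT.
  by rewrite inE => /andP[yS xy] ->; exists x y; rewrite // !inE ?xS ?yS ?orbT.
have dvu B : B \in induced_edges S -> [disjoint [set v; u] & B].
  move=> BS; have : B \subset S by rewrite -cS; exact: bigcup_sup.
  move=> /subsetP sBS; rewrite disjoint_subset; apply/subsetP => x xvu.
  rewrite inE; apply/negP => /sBS/SUv[_ xv xu _ _].
  by move: xvu; rewrite !inE (negbTE xv) (negbTE xu).
have vuS : [set v; u] \notin induced_edges S.
  apply/negP => /dvu; rewrite -setI_eq0 setIid => /eqP/setP/(_ v).
  by rewrite !inE eqxx.
have mS' : induced_matching (v |: (u |: S)).
  rewrite /induced_matching eE; apply/andP; split.
    apply/trivIsetP => A B /setU1P[->|AS] /setU1P[->|BS].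
    - by rewrite eqxx.
    - by move=> _; exact: dvu.
    - by move=> _; rewrite disjoint_sym; exact: dvu.
    - by move/trivIsetP: tS; apply.
  by rewrite /cover big_setU1 //= -/(cover _) cS setUA.
apply: (bigop.bigmax_sup (v |: (u |: S))); last by rewrite eE cardsU1 vuS.
rewrite mS' !subUset !sub1set vU uU /=.
by apply/subsetP => x /SUv[].
Qed.

(** * The weighted bound, by induction on the vertex set *)

Section Bound.
Variable R : realFieldType.

(** The bases are [a] and [b] of the overview. As they are rational, [lra] settles every numerical
    inequality of the branchings. *)
Definition weight U : R := (7 / 5) ^+ #|U| * (50 / 49) ^+ imU U.

Lemma ge1_a : 1 <= 7 / 5 :> R.
Proof. by lra. Qed.

Lemma ge1_b : 1 <= 50 / 49 :> R.
Proof. by lra. Qed.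

Lemma a2b : (7 / 5) ^+ 2 * (50 / 49) = 2 :> R.
Proof. by rewrite expr2; lra. Qed.

Lemma ge0_expa n : 0 <= (7 / 5) ^+ n :> R.
Proof. exact: exprn_ge0 (le_trans ler01 ge1_a). Qed.

Lemma ge0_expb n : 0 <= (50 / 49) ^+ n :> R.
Proof. exact: exprn_ge0 (le_trans ler01 ge1_b). Qed.

Lemma weight_ge0 U : 0 <= weight U.
Proof. exact: mulr_ge0 (ge0_expa _) (ge0_expb _). Qed.

Lemma weight_sub U V d : V \subset U -> (#|V| + d <= #|U|)%N ->
  weight V * (7 / 5) ^+ d <= weight U.
Proof.
move=> VU dU; rewrite /weight mulrAC -exprD.
apply: ler_pM; rewrite ?ge0_expa ?ge0_expb //.
  exact: ler_weXn2l ge1_a _ _ dU.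
by apply: (ler_weXn2l ge1_b); exact: imU_mono.
Qed.

Lemma weight_isolated_edge U v u : v \in U ->
  nbr v :&: U = [set u] -> nbr u :&: U = [set v] ->
  2 * weight (U :\: cnbr v) <= weight U.
Proof.
move=> vU Nv Nu; rewrite /weight -(card_cnbrD vU) Nv cards1 exprD.
rewrite mulrCA -a2b -[(7 / 5) ^+ 2 * _ * _]mulrA -exprS -mulrA.
do 2!(apply: ler_wpM2l; first exact: ge0_expa).
by apply: (ler_weXn2l ge1_b); exact: imU_isolated_edge Nu.
Qed.

Lemma card_MIS_weight U : triangle_free G -> #|MIS U|%:R <= weight U.
Proof.
move=> tf; have [n] := ubnP #|U|; elim: n => // n IHn in U *.
rewrite ltnS => Un.
(* The exponent [d.+1] makes [V] strictly smaller than [U]; the power is kept on the left to avoid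
   division. *)
have IH V d : V \subset U -> (#|V| + d.+1 <= #|U|)%N ->
    #|MIS V|%:R * (7 / 5) ^+ d.+1 <= weight U.
  move=> VU dU; apply: le_trans (weight_sub VU dU).
  apply: ler_wpM2r; first exact: ge0_expa.
  by apply: IHn; lia.
have wU0 := weight_ge0 U.
have natRle m p q : (m <= p + q)%N -> m%:R <= p%:R + q%:R :> R.
  by rewrite -natrD ler_nat.
have [->|[v vU]] := set_0Vmem U.
  apply: (le_trans (y := 1)); first by rewrite lern1 card_MIS0.
  by rewrite /weight mulr_ege1 // exprn_ege1 ?ge1_a ?ge1_b.
have cD w : w \in U -> forall d, (d <= #|nbr w :&: U|)%N ->
    #|MIS (U :\: cnbr w)|%:R * (7 / 5) ^+ d.+1 <= weight U.
  move=> wU d dw; apply: IH; first exact: subsetDl.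
  by have := card_cnbrD wU; lia.
case: (boolP [exists w in U, 2 < #|nbr w :&: U|]%N).
  move=> /exists_inP[w wU dw].
  have h1 := cD w wU 3%N dw.
  have h2 := IH (U :\ w) 0%N (subsetDl _ _).
  have {}h2 := h2 ltac:(by rewrite (cardsD1 w U) wU addnC).
  have h3 := natRle _ _ _ (card_MIS_del U w).
  by lra.
rewrite negb_exists_in => /forall_inP degle2.
(* An isolated vertex belongs to every maximal independent set, so there is a single branch. *)
case: (boolP [exists w in U, #|nbr w :&: U| == 0]%N).
  move=> /exists_inP[w wU]; rewrite cards_eq0 => /eqP Nw.
  have h1 := cD w wU 0%N isT.
  have h2 : #|MIS U|%:R <= #|MIS (U :\: cnbr w)|%:R :> R.
    by rewrite ler_nat card_MIS_isolated.
  have h3 : 0 <= #|MIS (U :\: cnbr w)|%:R :> R by [].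
  by lra.
rewrite negb_exists_in => /forall_inP degn0.
case: (boolP [exists w in U, #|nbr w :&: U| == 1]%N).
  move=> /exists_inP[w wU /cards1P[u Nw]].
  have h := natRle _ _ _ (card_MIS_leaf wU Nw).
  have uU : u \in U.
    by have := set11 u; rewrite -Nw inE => /andP[].
  have wu : w \in nbr u :&: U.
    have := set11 u; rewrite -Nw !inE wU => /andP[].
    by rewrite adj_sym => ->.
  have [du|du] := ltnP 1 #|nbr u :&: U|.
    have h1 := cD w wU 1%N ltac:(by rewrite Nw cards1).
    have h2 := cD u uU 2%N du.
    have h3 : 0 <= #|MIS (U :\: cnbr w)|%:R :> R by [].
    by lra.
  have Nu : nbr u :&: U = [set w].
    by apply/esym/eqP; rewrite eqEcard sub1set wu cards1.
  (* On an isolated edge both branches delete the same two vertices, whence the factor 2. *)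
  have eqD : U :\: cnbr u = U :\: cnbr w.
    apply/setP => x; have := congr1 (fun A : {set G} => x \in A) Nw.
    have := congr1 (fun A : {set G} => x \in A) Nu; rewrite !inE.
    by case: (x \in U); rewrite ?andbT ?andbF // => -> ->; rewrite orbC.
  rewrite eqD in h.
  have h1 : #|MIS (U :\: cnbr w)|%:R <= weight (U :\: cnbr w).
    by apply: IHn; have := card_cnbrD wU; lia.
  by have := weight_isolated_edge wU Nw Nu; lra.
rewrite negb_exists_in => /forall_inP degn1.
have deg2 w : w \in U -> #|nbr w :&: U| = 2%N.
  move=> wU; have := degle2 w wU; have := degn0 w wU.
  by have := degn1 w wU; lia.
have [u /setIP[]] : exists u, u \in nbr v :&: U.
  by apply/card_gt0P; rewrite deg2.
rewrite inE => vu uU.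
have delv w : (nbr w :&: U) :\ v = nbr w :&: (U :\ v) by rewrite setIDA.
have uU' : u \in U :\ v.
  by rewrite !inE uU andbT; apply: contraTneq vu => ->; rewrite adj_irrefl.
have cU' : (#|U :\ v|.+1 = #|U|)%N by rewrite (cardsD1 v U) vU.
have /eqP/cards1P[u' Nu] : #|nbr u :&: (U :\ v)| = 1%N.
  have := cardsD1 v (nbr u :&: U).
  by rewrite deg2 // delv !inE vU adj_sym vu => -[].
have := set11 u'; rewrite -Nu !inE => /and3P[uu' u'v u'U].
have Nu' : #|nbr u' :&: (U :\ v)| = 2%N.
  have := cardsD1 v (nbr u' :&: U); rewrite deg2 // delv !inE vU andbT.
  (* An edge from [u'] to [v] would close the triangle [v], [u], [u']; hence deleting [v] does not
     lower the degree of [u']. *)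
  suff /negbTE -> : ~~ adj u' v by [].
  by have := tf v u u'; rewrite vu uu'.
(* Branching on [v], then on the leaf [u] of [U :\ v], leaves three sets, smaller than [U] by 3, 3
   and 4 vertices. *)
have h1 := natRle _ _ _ (card_MIS_del U v).
have h2 := natRle _ _ _ (card_MIS_leaf uU' Nu).
have h3 := cD v vU 2%N ltac:(by rewrite deg2).
have sub w : (U :\ v) :\: cnbr w \subset U.
  by rewrite (subset_trans (subsetDl _ _)) ?subsetDl.
have h4 := IH _ 2%N (sub u) ltac:(
  by rewrite -cU' -(card_cnbrD uU') Nu cards1 addnS).
have u'U' : u' \in U :\ v by rewrite !inE u'v.
have h5 := IH _ 3%N (sub u') ltac:(
  by rewrite -cU' -(card_cnbrD u'U') Nu' addnS).
by lra.
Qed.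

End Bound.
End InducedSubgraphs.

(** * Passage to logarithms *)

Theorem theorem1p4 (R : realType) :
  exists c : R, 0 < c /\
    forall eps : R, 0 < eps ->
      exists delta : R, c * eps <= delta /\
        forall (n : nat) (G : sgraph), #|G| = n -> triangle_free G ->
          (im G)%:R < (1 - eps) * (n%:R / 2) ->
          log2 (mis G)%:R < (1 / 2 - delta) * n%:R.
Proof.
have a0 : 0 < 7 / 5 :> R by lra.
have b0 : 0 < 50 / 49 :> R by lra.
have ln2 : 0 < ln 2 :> R by rewrite ln_gt0 //; lra.
have lnb : 0 < ln (50 / 49) :> R by rewrite ln_gt0 //; lra.
exists (ln (50 / 49) / ln 2 / 2); split; first by rewrite !divr_gt0.
move=> eps eps0; exists (ln (50 / 49) / ln 2 / 2 * eps); split=> //.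
move=> n G Gn tf imG; rewrite /log2 ltr_pdivrMr //.
have mle := card_MIS_weight R setT tf.
rewrite -mis_MIS /weight cardsT Gn -im_imU in mle.
have ab : 2 * ln (7 / 5) + ln (50 / 49) = ln 2 :> R.
  by rewrite mulr_natl -lnXn // -lnM ?posrE ?exprn_gt0 // a2b.
have lnle : ln (mis G)%:R <= n%:R * ln (7 / 5) + (im G)%:R * ln (50 / 49) :> R.
  rewrite (mulr_natl _ n) (mulr_natl _ (im G)) -!lnXn //.
  rewrite -lnM ?posrE ?exprn_gt0 //.
  by rewrite ler_ln ?posrE ?mulr_gt0 ?exprn_gt0 ?ltr0n ?mis_gt0.
apply: (le_lt_trans lnle).
(* By [ab], the target is the bound of [lnle] with [im G] replaced by [(1 - eps) * (n%:R / 2)].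
   Strictness then comes from [imG] and [lnb]. *)
have -> : (1 / 2 - ln (50 / 49) / ln 2 / 2 * eps) * n%:R * ln 2 =
    n%:R * ln (7 / 5) + (1 - eps) * (n%:R / 2) * ln (50 / 49) :> R.
  rewrite -ab; field; rewrite ab; exact: lt0r_neq0.
by rewrite ltrD2l ltr_pM2r.
Qed.
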